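(* Let $H$ be an infinite dimensional Hilbert space. Let $K\geq 4$, let $V\subset\binom{[K]}{4}$ be such that $\bigcup V=[K]$, and let $\alpha:V\to\{0,1\}$ be any function. Then there exist closed subspaces $L_1,\dots,L_K\subset H$ with the following properties. If $A\in V$ and $\alpha(A)=0$, then $\bigcap_{i\in A}L_i$ is infinite dimensional. If $A\in V$ and $\alpha(A)=1$, then $\sum_{i\in A}L_i^{\perp}$ is not closed. If $B\in\binom{[K]}{4}\setminus V$, then $\bigcap_{i\in B}L_i$ is finite dimensional and $\sum_{i\in B}L_i^{\perp}$ is closed.
   Context: $[K]=\{1,\dots,K\}$; $\binom{[K]}{4}$ is the set of all $4$-element subsets of $[K]$; $\bigcup V$ is the union of the members of $V$. $X^\perp$ is the orthogonal complement of $X$ in $H$. *)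

(* Defs.v *)
From HB Require Import structures.
From mathcomp Require Import all_boot all_order all_algebra.
From mathcomp Require Import complex.
From mathcomp Require Import all_classical all_reals all_analysis.
Set Implicit Arguments.
Unset Strict Implicit.
Unset Printing Implicit Defensive.
Import Order.TTheory GRing.Theory Num.Theory.
Import numFieldNormedType.Exports.

Local Open Scope classical_set_scope.
Local Open Scope ring_scope.

(* The scalar field of a Hilbert space is either the reals, with trivial
   conjugation, or the complex numbers, with complex conjugation. *)
Variant hilbert_scalars (R : realType) :
    forall F : numFieldType, (F -> F) -> Prop :=
  | real_scalars : @hilbert_scalars R R idfun
  | complex_scalars : @hilbert_scalars R R[i] Num.conj.

(* A complete normed module is a Hilbert space when its norm is the one
   induced by a positive definite hermitian form. *)
Definition induces_norm (F : numFieldType) (theta : F -> F)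
    (H : completeNormedModType F) (form : {dot H for theta}) : Prop :=
  forall x : H, `|x| ^+ 2 = form x x.

Definition closed_subspace (F : numFieldType) (H : normedModType F)
    (L : set H) : Prop :=
  submod_closed (mem L) /\ closed L.

Definition lin_span (F : numFieldType) (H : lmodType F) (s : seq H) : set H :=
  [set x | exists c : 'I_(size s) -> F, x = \sum_(i < size s) c i *: s`_i].

(* Only meant for linear subspaces [W]. *)
Definition finite_dimensional (F : numFieldType) (H : lmodType F)
    (W : set H) : Prop :=
  exists s : seq H, W = lin_span s.

Definition infinite_dimensional (F : numFieldType) (H : lmodType F)
    (W : set H) : Prop :=
  ~ finite_dimensional W.

Definition ortho_compl (F : numFieldType) (theta : F -> F) (H : lmodType F)
    (form : {dot H for theta}) (X : set H) : set H :=
  [set y | forall x, X x -> form x y = 0].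

Definition sum_of_subspaces (H : zmodType) (I : finType) (A : {set I})
    (W : I -> set H) : set H :=
  [set x | exists2 w : I -> H,
     (forall i, i \in A -> W i (w i)) & x = \sum_(i in A) w i].

(* Main.v *)
Require Import Defs.
From HB Require Import structures.
From mathcomp Require Import all_boot all_order all_algebra.
From mathcomp Require Import complex.
From mathcomp Require Import all_classical all_reals all_analysis.
Set Implicit Arguments.
Unset Strict Implicit.
Unset Printing Implicit Defensive.
Import Order.TTheory GRing.Theory Num.Theory.
Import numFieldNormedType.Exports.

Local Open Scope classical_set_scope.
Local Open Scope ring_scope.

(** Fix an orthonormal sequence of H and cut it into blocks, one block H_A for
    each finite set A of indices; H_A is spanned by two orthonormal sequences
    a_n, b_n, and N is the orthogonal complement of all the blocks. The
    subspaces L_i are assembled block by block, and it is easiest to prescribe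
    their complements: L_i^perp contains N, and it contains the whole block H_A
    unless A is in V and i is in A. A set B outside V is different from every A
    in V and of the same cardinality, hence not included in A, so every block is
    contained in some L_i^perp with i in B. Thus the sum of the L_i^perp over B
    is H and the intersection of the L_i is 0. For A in V only the block H_A
    itself matters, and there the L_i^perp with i in A are free.

    If alpha A = 0, they are trivial on H_A, so the intersection of the L_i
    contains H_A. If alpha A = 1, one of them, for a chosen index of A, is
    spanned by the vectors a_n + 2^-n b_n and the others by the a_n. Their sum
    contains every b_n, so its closure contains y = sum_n 2^-n b_n. If y were
    in the sum, its component w in the tilted subspace would have coordinates
    2^-n along b_n, hence coordinates 1 along all the a_n, against Bessel's
    inequality.

    The Hilbert space theory behind this is Bessel's inequality and the
    Riesz-Fischer theorem [riesz_fischer], which give the orthogonal projection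
    on the closed span of an orthonormal sequence, and from it the decomposition
    of a vector along finitely many such sequences
    [orthonormal_decomposition]. Real and complex scalars are treated at once,
    through the two facts that c times its conjugate is |c|^2 and that the field
    is archimedean. Together with the completeness of H, the latter is enough
    for orthonormal series to converge, because a bounded series with
    nonnegative terms in an archimedean field has arbitrarily small tails. *)

(** * Scalars *)

(** Common ground of the real and the complex case: the identity of the reals
    and the conjugation of the complex numbers both satisfy these laws. *)
Record conjugation (F : numFieldType) (theta : F -> F) : Prop := Conjugation {
  conjugation0 : theta 0 = 0;
  mul_conjugation : forall c, c * theta c = `|c| ^+ 2 }.

Lemma hilbert_scalars_conjugation (R : realType) (F : numFieldType)
    (theta : F -> F) : hilbert_scalars R theta -> conjugation theta.
Proof.
case; split=> /=.
- by [].
- by move=> c; rewrite -normrX ger0_norm ?sqr_ge0// expr2.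
- by rewrite conjC0.
- by move=> c; rewrite normCK.
Qed.

Lemma hilbert_scalars_archimedean (R : realType) (F : numFieldType)
    (theta : F -> F) : hilbert_scalars R theta ->
  forall x : F, exists n : nat, `|x| < n%:R.
Proof.
case=> x; first by exists (Num.bound `|x|); exact: archi_boundP.
pose r := complex.Re `|x|.
have xE : `|x| = r%:C%C by rewrite RRe_real ?normr_real.
exists (Num.bound r); rewrite xE -(rmorph_nat (real_complex R)) ltcR.
by apply: archi_boundP; rewrite -lecR -xE normr_ge0.
Qed.

Lemma conjugation_nneg (F : numFieldType) (theta : F -> F)
    (conjF : conjugation theta) c :
  0 <= c -> theta c = c.
Proof.
move=> c0; have [->|cN0] := eqVneq c 0; first exact: conjugation0.
by apply: (mulfI cN0); rewrite mul_conjugation// ger0_norm// expr2.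
Qed.

(** If every tail had a partial sum at least [eps], then stacking j consecutive
    ones would give a partial sum at least [j * eps], which exceeds [M] for
    large j. This takes the place of the convergence of bounded monotone
    sequences, and also holds in the partially ordered complex field. *)
Lemma bounded_series_small_tails (F : numFieldType) (d : nat -> F) (M : F) :
  Num.archimedean_axiom F -> (forall k, 0 <= d k) ->
  (forall n, series d n <= M) ->
  forall eps, 0 < eps ->
  exists N, forall n, (N <= n)%N -> \sum_(N <= k < n) d k < eps.
Proof.
move=> archF d0 dM eps eps0; apply: contrapT => /forallNP noN.
have tail_ge0 m n : 0 <= \sum_(m <= k < n) d k by exact: sumr_ge0.
have big N : exists2 n, (N <= n)%N & eps <= \sum_(N <= k < n) d k.
  have /existsNP[n /not_implyP[Nn /negP tail]] := noN N.
  by exists n => //; rewrite real_leNgt ?ger0_real ?(ltW eps0).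
have grow j : exists n, j%:R * eps <= series d n.
  elim: j => [|j [n jn]]; first by exists 0%N; rewrite mul0r tail_ge0.
  have [n' nn' n'P] := big n; exists n'.
  rewrite -(subrK (series d n) (series d n')) sub_series_geq//.
  by rewrite -natr1 mulrDl mul1r addrC lerD.
have [j Mj] := archF (M / eps); have [n jn] := grow j.
have M0 : 0 <= M by apply: le_trans (dM 0%N); rewrite seriesEnat tail_ge0.
move: Mj; rewrite ger0_norm ?divr_ge0 ?(ltW eps0)// ltr_pdivrMr//.
by move=> /(le_lt_trans (le_trans jn (dM n))); rewrite ltxx.
Qed.

(** * Inner products *)

Section Form.
Variables (F : numFieldType) (theta : F -> F) (conjF : conjugation theta).
Variables (H : completeNormedModType F) (form : {dot H for theta}).
Hypothesis hilbertH : induces_norm form.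

Lemma dotC x y : form x y = theta (form y x).
Proof. by have := @hermitian_subproof _ _ _ _ form x y; rewrite mul1r. Qed.

Lemma dot_eq0C x y : form x y = 0 -> form y x = 0.
Proof. by move=> xy0; rewrite dotC xy0 conjugation0. Qed.

Lemma dot0l y : form 0 y = 0.
Proof. exact: linear0l. Qed.

Lemma dot0r x : form x 0 = 0.
Proof. exact: linear0r. Qed.

Lemma dotDl x y z : form (x + y) z = form x z + form y z.
Proof. exact: linearDl. Qed.

Lemma dotDr x y z : form x (y + z) = form x y + form x z.
Proof. exact: linearDr. Qed.

Lemma dotBl x y z : form (x - y) z = form x z - form y z.
Proof. exact: linearBl. Qed.

Lemma dotBr x y z : form x (y - z) = form x y - form x z.
Proof. exact: linearBr. Qed.

Lemma dot_suml (I : Type) (r : seq I) (P : pred I) (u : I -> H) y :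
  form (\sum_(i <- r | P i) u i) y = \sum_(i <- r | P i) form (u i) y.
Proof. exact: linear_sumlz. Qed.

Lemma dot_sumr (I : Type) (r : seq I) (P : pred I) (u : I -> H) x :
  form x (\sum_(i <- r | P i) u i) = \sum_(i <- r | P i) form x (u i).
Proof. exact: linear_sumr. Qed.

Lemma dotZl c x y : form (c *: x) y = c * form x y.
Proof. exact: linearZl_LR. Qed.

Lemma dotZr c x y : form x (c *: y) = theta c * form x y.
Proof. exact: linearZr_LR. Qed.

Lemma pythagoras x y : form x y = 0 -> `|x + y| ^+ 2 = `|x| ^+ 2 + `|y| ^+ 2.
Proof.
move=> xy0; rewrite !hilbertH dotDl !dotDr xy0 (dot_eq0C xy0).
by rewrite addr0 add0r.
Qed.

(** Pythagoras' theorem for [x], split into its projection on the line of [y]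
    and the rest. *)
Lemma cauchy_schwarz x y : `|form x y| <= `|x| * `|y|.
Proof.
have [->|yN0] := eqVneq y 0; first by rewrite dot0r !normr0 mulr0.
have ny0 : 0 < `|y| by rewrite normr_gt0.
pose c := form x y / `|y| ^+ 2.
have perp : form (x - c *: y) (c *: y) = 0.
  rewrite dotZr dotBl dotZl -hilbertH divfK ?subrr ?mulr0//.
  by rewrite expf_neq0// gt_eqF.
have := pythagoras perp; rewrite subrK => xE.
have : `|c *: y| <= `|x|.
  rewrite -(@ler_pXn2r _ 2)// ?nnegrE// xE lerDr exprn_ge0//.
rewrite normrZ /c normrM normfV (ger0_norm (exprn_ge0 _ _))//.
by rewrite expr2 invfM mulrA mulfVK ?gt_eqF// ler_pdivrMr.
Qed.

Lemma dot_continuousl y : continuous (fun x : H => form x y : F).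
Proof.
move=> x; apply/cvgrPdist_lt => e e0; near=> z.
rewrite -dotBl (le_lt_trans (cauchy_schwarz _ _))//.
have y1 : 0 < `|y| + 1 by rewrite ltr_wpDl.
apply: (@le_lt_trans _ _ (`|x - z| * (`|y| + 1))).
  by rewrite ler_wpM2l// lerDl.
rewrite -ltr_pdivlMr//; near: z.
by apply: cvgr_dist_lt => //; rewrite divr_gt0.
Unshelve. all: by end_near. Qed.

Lemma ortho_compl_closed_subspace (S : set H) :
  closed_subspace (ortho_compl form S).
Proof.
split.
  split=> [|a x y]; rewrite !inE => //=; first by move=> s _; rewrite dot0r.
  move=> xS yS s Ss; rewrite dotDr dotZr (xS _ Ss) (yS _ Ss).
  by rewrite mulr0 addr0.
have -> : ortho_compl form S = \bigcap_(s in S) ((form^~ s) @^-1` [set 0]).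
  by apply/seteqP; split=> x xS s Ss; apply: dot_eq0C; exact: xS.
apply: closed_bigI => s _; apply: preimage_closed.
  by move=> x _; exact: dot_continuousl.
apply: accessible_closed_set1; apply: hausdorff_accessible.
exact: norm_hausdorff.
Qed.

Lemma sub_ortho_complK (S : set H) x :
  S x -> ortho_compl form (ortho_compl form S) x.
Proof. by move=> Sx y yS; apply: dot_eq0C; exact: yS. Qed.
End Form.

(** * Closed subspaces and their sums *)

Section ClosedSubspaces.
Variables (F : numFieldType) (H : normedModType F) (L : set H).
Hypothesis Lcl : closed_subspace L.

Lemma closed_subspace0 : L 0.
Proof. by case: Lcl => -[]; rewrite inE. Qed.

Lemma closed_subspaceD x y : L x -> L y -> L (x + y).
Proof. by case: Lcl => -[_ /(_ 1 x y)]; rewrite !inE scale1r. Qed.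

Lemma closed_subspaceZ a x : L x -> L (a *: x).
Proof.
move=> Lx; case: Lcl => -[_ /(_ a x 0)]; rewrite !inE addr0 => LZ _.
exact: LZ Lx closed_subspace0.
Qed.
End ClosedSubspaces.

Section Sums.
Variables (F : numFieldType) (H : normedModType F) (I : finType).
Variables (A : {set I}) (W : I -> set H).
Hypothesis Wsub : forall i, closed_subspace (W i).

Lemma sum_of_subspaces0 : sum_of_subspaces A W 0.
Proof.
exists (fun=> 0) => [i _|]; first exact: closed_subspace0.
by rewrite big1.
Qed.

Lemma sum_of_subspacesD x y : sum_of_subspaces A W x ->
  sum_of_subspaces A W y -> sum_of_subspaces A W (x + y).
Proof.
move=> [u uW ->] [v vW ->]; exists (fun i => u i + v i); last first.
  by rewrite big_split.
by move=> i iA; apply: closed_subspaceD; [exact: Wsub|exact: uW|exact: vW].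
Qed.

Lemma sub_sum_of_subspaces i x : i \in A -> W i x -> sum_of_subspaces A W x.
Proof.
move=> iA Wx; exists (fun j => if j == i then x else 0).
  by move=> j _; case: eqP => [->//|_]; exact: closed_subspace0.
by rewrite (bigD1 i)//= eqxx big1 ?addr0// => j /andP[_ /negPf->].
Qed.
End Sums.

(** * Orthonormal expansions *)

Section Orthonormal.
Variables (F : numFieldType) (theta : F -> F) (conjF : conjugation theta).
Variables (H : completeNormedModType F) (form : {dot H for theta}).
Hypothesis hilbertH : induces_norm form.

Definition orthonormal_family (T : eqType) (e : T -> H) : Prop :=
  forall s t, form (e s) (e t) = (s == t)%:R.

Lemma orthonormal_comp (T U : eqType) (e : T -> H) (f : U -> T) :
  orthonormal_family e -> injective f -> orthonormal_family (e \o f).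
Proof. by move=> eP f_inj s t; rewrite /= eP inj_eq. Qed.

Lemma dot_sum_coef (T : finType) (e : T -> H) (c : T -> F) t :
  orthonormal_family e -> form (\sum_s c s *: e s) (e t) = c t.
Proof.
move=> eP; rewrite dot_suml (bigD1 t)//= big1.
  by rewrite dotZl eP eqxx mulr1 addr0.
by move=> s /negPf st; rewrite dotZl eP st mulr0.
Qed.

Variables (e : nat -> H) (eP : orthonormal_family e).

(** The coefficient of [e k] does not change any more once the partial sum
    includes it. *)
Lemma dot_series_coef (c : nat -> F) n k : (k < n)%N ->
  form (series (fun j => c j *: e j) n) (e k) = c k.
Proof.
move=> kn; rewrite seriesEord/=.
exact: (dot_sum_coef _ (Ordinal kn) (orthonormal_comp eP (@ord_inj n))).
Qed.

Lemma norm_sum_orthonormal (c : nat -> F) m n :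
  `|\sum_(m <= k < n) c k *: e k| ^+ 2 = \sum_(m <= k < n) `|c k| ^+ 2.
Proof.
elim: n => [|n IHn]; first by rewrite !big_geq// normr0 expr0n.
have [mn|nm] := leqP m n; last by rewrite !big_geq// normr0 expr0n.
rewrite !big_nat_recr//= (pythagoras conjF hilbertH) ?IHn; last first.
  rewrite dot_suml big_nat big1// => k /andP[_ kn].
  by rewrite dotZl dotZr eP ltn_eqF// !mulr0.
congr (_ + _); rewrite hilbertH dotZl dotZr eP eqxx mulr1.
by rewrite (mul_conjugation conjF).
Qed.

(** The squared norm of [x] is the squared norm of its projection on the span of
    the first [n] vectors, i.e. the partial sum, plus that of the rest. *)
Lemma bessel x n : series (fun k => `|form x (e k)| ^+ 2) n <= `|x| ^+ 2.
Proof.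
pose s := series (fun k => form x (e k) *: e k) n.
have perp : form (x - s) s = 0.
  rewrite {2}/s seriesEord/= dot_sumr big1// => k _.
  by rewrite dotZr dotBl dot_series_coef ?subrr ?mulr0.
have := pythagoras conjF hilbertH perp; rewrite subrK => ->.
by rewrite {2}/s !seriesEnat norm_sum_orthonormal lerDr exprn_ge0.
Qed.

(** By orthonormality the squared distance between two partial sums is a
    partial sum of a tail of the series of the [`|c k| ^+ 2], so that small
    tails make the partial sums a Cauchy sequence. Coefficients pass to the
    limit because the inner product is continuous. *)
Lemma riesz_fischer (c : nat -> F) (M : F) : Num.archimedean_axiom F ->
  (forall n, series (fun k => `|c k| ^+ 2) n <= M) ->
  exists2 y, series (fun k => c k *: e k) @ \oo --> y &
    forall k, form y (e k) = c k.
Proof.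
move=> archF cM; set s := series _.
have : cauchy (s @ \oo).
  apply: cauchy_exP => eps eps0.
  have d0 k : 0 <= `|c k| ^+ 2 by rewrite exprn_ge0.
  have eps20 : 0 < eps ^+ 2 by rewrite exprn_gt0.
  have [N NP] := bounded_series_small_tails archF d0 cM eps20.
  exists (s N); exists N => // n Nn; rewrite -ball_normE /= distrC.
  rewrite -(@ltr_pXn2r _ 2) ?nnegrE ?normr_ge0 ?(ltW eps0)// sub_series_geq//.
  by rewrite norm_sum_orthonormal NP.
move=> /cauchy_cvgP /cvg_ex[y sy]; exists y => // k.
have lim : form (s n) (e k) @[n --> \oo] --> form y (e k).
  exact: (cvg_comp s _ sy (@dot_continuousl _ _ conjF _ _ hilbertH (e k) y)).
have limc : form (s n) (e k) @[n --> \oo] --> c k.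
  apply: cvg_near_cst; near=> n; apply/eqP; rewrite dot_series_coef//.
  by near: n; exists k.+1.
by apply: cvg_unique lim limc; exact: norm_hausdorff.
Unshelve. all: by end_near. Qed.

Lemma orthonormal_projection x : Num.archimedean_axiom F ->
  exists2 y, series (fun k => form x (e k) *: e k) @ \oo --> y &
    forall k, form y (e k) = form x (e k).
Proof. by move=> archF; apply: riesz_fischer => // n; exact: bessel. Qed.

Lemma closed_subspace_series (L : set H) (c : nat -> F) y :
  closed_subspace L -> (forall k, L (e k)) ->
  series (fun k => c k *: e k) @ \oo --> y -> L y.
Proof.
move=> Lcl Le; apply: closed_cvg; first by case: Lcl.
near=> n; rewrite seriesEord/=; elim/big_ind: _ => [||k _].
- exact: closed_subspace0.
- exact: closed_subspaceD.
- exact: closed_subspaceZ.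
Unshelve. all: by end_near. Qed.
End Orthonormal.

Section Decomposition.
Variables (F : numFieldType) (theta : F -> F) (conjF : conjugation theta).
Variables (H : completeNormedModType F) (form : {dot H for theta}).
Hypothesis hilbertH : induces_norm form.

(** [q i] is the projection of [x] on the closed span of the [i]-th sequence.
    That it lies in this closed span is expressed by its membership in every
    closed subspace containing the sequence. Since the spans are pairwise
    orthogonal, removing all the projections leaves a vector orthogonal to every
    sequence. *)
Lemma orthonormal_decomposition (I : finType) (e : I * nat -> H) x :
  Num.archimedean_axiom F -> orthonormal_family form e ->
  exists2 q : I -> H,
    forall i (L : set H), closed_subspace L ->
      (forall k, L (e (i, k))) -> L (q i) &
    forall t, form (x - \sum_i q i) (e t) = 0.
Proof.
move=> archF eP.
have eiP i : orthonormal_family form (fun k => e (i, k)).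
  by move=> j k; rewrite eP xpair_eqE eqxx.
pose q i :=
  s2val (cid2 (orthonormal_projection conjF hilbertH (eiP i) x archF)).
have qlim i : series (fun k => form x (e (i, k)) *: e (i, k)) @ \oo --> q i.
  by rewrite /q; case: cid2.
have qcoef i k : form (q i) (e (i, k)) = form x (e (i, k)).
  by rewrite /q; case: cid2.
have qL i L : closed_subspace L -> (forall k, L (e (i, k))) -> L (q i).
  by move=> Lcl Le; exact: (closed_subspace_series Lcl Le (qlim i)).
exists q => // -[i k]; rewrite dotBl dot_suml (bigD1 i)//= qcoef big1.
  by rewrite addr0 subrr.
move=> j ji; apply: (dot_eq0C conjF).
(* The complement of e (i, k) is a closed subspace containing the j-th
   sequence. *)
suff : ortho_compl form [set e (i, k)] (q j) by exact.
apply: qL; first exact: ortho_compl_closed_subspace.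
by move=> l _ ->; rewrite eP xpair_eqE eq_sym (negPf ji).
Qed.
End Decomposition.

(** * Infinite dimension and orthonormal sequences *)

Section Dimension.
Variables (F : numFieldType) (theta : F -> F) (conjF : conjugation theta).
Variables (H : completeNormedModType F) (form : {dot H for theta}).
Hypothesis hilbertH : induces_norm form.

(** If [L] were spanned by k vectors, then k + 1 vectors of [e] would satisfy a
    nontrivial linear relation, but pairing this relation with each of them
    shows that its coefficients vanish. *)
Lemma infinite_dimensional_orthonormal (L : set H) (e : nat -> H) :
  orthonormal_family form e -> (forall n, L (e n)) -> infinite_dimensional L.
Proof.
move=> eP Le [s Ls].
have coef (i : 'I_(size s).+1) :
    exists c : 'I_(size s) -> F, e i = \sum_(j < size s) c j *: s`_j.
  by have := Le i; rewrite Ls.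
have [c cP] := choice coef.
pose C : 'M[F]_((size s).+1, size s) := \matrix_(i, j) c i j.
suff : row_free C.
  rewrite /row_free => /eqP rankC.
  by have := rank_leq_col C; rewrite rankC ltnn.
apply: inj_row_free => v vC0; apply/rowP => i; rewrite mxE.
rewrite -(dot_sum_coef (v 0) i (orthonormal_comp eP (@ord_inj _)))/=.
suff -> : \sum_(k < (size s).+1) v 0 k *: e k = 0 by rewrite dot0l.
under eq_bigr do rewrite cP scaler_sumr.
rewrite exchange_big big1// => j _; under eq_bigr do rewrite scalerA.
rewrite -scaler_suml; have /rowP/(_ j) := vC0; rewrite !mxE.
by under eq_bigr do rewrite mxE; move=> ->; rewrite scale0r.
Qed.

(** One Gram-Schmidt step. *)
Lemma orthonormal_extension (s : seq H) : infinite_dimensional [set: H] ->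
  orthonormal_family form (fun i : 'I_(size s) => s`_i) ->
  exists2 u, form u u = 1 & forall i : 'I_(size s), form u s`_i = 0.
Proof.
move=> infH sP.
have [x xNs] : exists x, ~ lin_span s x.
  apply: contrapT => /forallNP all_span; apply: infH; exists s.
  by apply/seteqP; split=> // x _; exact: contrapT (all_span x).
pose y := x - \sum_(i < size s) form x s`_i *: s`_i.
have yN0 : `|y| != 0.
  rewrite normr_eq0 subr_eq0; apply/eqP => xE.
  by apply: xNs; exists (fun i => form x s`_i).
exists (`|y|^-1 *: y) => [|i]; last first.
  by rewrite dotZl dotBl (dot_sum_coef _ _ sP) subrr mulr0.
by rewrite -hilbertH normrZ ger0_norm ?invr_ge0// mulVf// expr1n.
Qed.

Lemma exists_orthonormal_sequence : infinite_dimensional [set: H] ->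
  exists e : nat -> H, orthonormal_family form e.
Proof.
move=> infH.
pose extends (s : seq H) u :=
  form u u = 1 /\ forall i, (i < size s)%N -> form u s`_i = 0.
pose next s := xget 0 (extends s).
pose pre :=
  fix pre n := if n is m.+1 then rcons (pre m) (next (pre m)) else [::].
pose e n := next (pre n).
have size_pre n : size (pre n) = n.
  by elim: n => //= n IHn; rewrite size_rcons IHn.
have nth_pre n i : (i < n)%N -> (pre n)`_i = e i.
  elim: n => //= n IHn; rewrite nth_rcons size_pre ltnS leq_eqVlt.
  by case/predU1P => [->|ltin]; rewrite ?ltnn ?eqxx// ltin IHn.
have eP n : extends (pre n) (e n).
  elim/ltn_ind: n => n IHn; apply: xgetPex.
  have sP : orthonormal_family form (fun i : 'I_(size (pre n)) => (pre n)`_i).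
    move=> i j; have := ltn_ord i; have := ltn_ord j; rewrite -val_eqE/=.
    case: i j => i /= _ [j /= _]; rewrite size_pre => jn ltin.
    rewrite !nth_pre//.
    have [ij|ji|->] := ltngtP i j; last by case: (IHn j jn).
    - apply: (dot_eq0C conjF); have [_ /(_ i)] := IHn j jn.
      by rewrite size_pre nth_pre//; exact.
    - have [_ /(_ j)] := IHn i ltin.
      by rewrite size_pre nth_pre//; exact.
  have [u u1 us] := orthonormal_extension infH sP.
  by exists u; split=> // i isz; exact: us (Ordinal isz).
exists e => i j; have [ij|ji|->] := ltngtP i j; last by case: (eP j).
- apply: (dot_eq0C conjF); have [_ /(_ i)] := eP j.
  by rewrite size_pre nth_pre//; exact.
- have [_ /(_ j)] := eP i.
  by rewrite size_pre nth_pre//; exact.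
Qed.
End Dimension.

(** * Subspaces built from blocks *)

Section Construction.
Variables (F : numFieldType) (theta : F -> F) (conjF : conjugation theta).
Hypothesis archF : Num.archimedean_axiom F.
Variables (H : completeNormedModType F) (form : {dot H for theta}).
Hypothesis hilbertH : induces_norm form.
Variables (I : finType) (V D : {set {set I}}).
Variable e : {set I} * bool * nat -> H.
Hypothesis eP : orthonormal_family form e.

(** The slope of the tilted vectors. The argument needs it to be positive and
    square summable. *)
Definition weight (n : nat) : F := 2^-1 ^+ n.

Lemma weight_gt0 n : 0 < weight n.
Proof. by rewrite exprn_gt0// invr_gt0 ltr0n. Qed.

Lemma weight_square_summable n :
  series (fun k => `|weight k| ^+ 2) n <= (1 - 2^-1 ^+ 2)^-1.
Proof.
set q : F := 2^-1 ^+ 2.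
have q0 : 0 < q by rewrite exprn_gt0// invr_gt0 ltr0n.
have q1 : q < 1 by rewrite exprn_ilt1 ?invr_ge0 ?ler0n// invf_lt1 ?ltr0n ?ltr1n.
have -> : series (fun k => `|weight k| ^+ 2) n = \sum_(i < n) q ^+ i.
  rewrite seriesEord/=; apply: eq_bigr => k _.
  by rewrite ger0_norm ?(ltW (weight_gt0 k))// -exprM mulnC exprM.
rewrite -[leRHS]mul1r ler_pdivlMr ?subr_gt0// mulrC.
by rewrite -opprB mulNr -subrX1 opprB gerBl exprn_ge0// ltW.
Qed.

(** Selects one element of each nonempty set [A], the only index whose
    complement is tilted in the block of [A]. *)
Definition tilt_index (A : {set I}) (i : I) : bool := [pick j in A] == Some i.

(** Spanning vectors of the complement of the [i]-th subspace. The vectors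
    [e (A, false, n)] and [e (A, true, n)] form the block of [A]; [V] is the
    given family, and [D] consists of its members whose sum must fail to be
    closed. *)
Variant annihilator (i : I) : set H :=
| annihilator_rest x of (forall t, form x (e t) = 0) : annihilator i x
| annihilator_block A b n of ~~ ((A \in V) && (i \in A)) :
    annihilator i (e (A, b, n))
| annihilator_axis A n of A \in D & i \in A & ~~ tilt_index A i :
    annihilator i (e (A, false, n))
| annihilator_tilted A n of A \in D & i \in A & tilt_index A i :
    annihilator i (e (A, false, n) + weight n *: e (A, true, n)).

Definition subspace_of (i : I) : set H := ortho_compl form (annihilator i).

Let perp (i : I) : set H := ortho_compl form (subspace_of i).

Lemma annihilator_perp i x : annihilator i x -> perp i x.
Proof. exact: (sub_ortho_complK conjF). Qed.

Lemma perp_closed_subspace i : closed_subspace (perp i).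
Proof. exact: ortho_compl_closed_subspace. Qed.

Lemma dot_block A b n A' b' n' : A != A' ->
  form (e (A, b, n)) (e (A', b', n')) = 0.
Proof. by move=> /negPf AA'; rewrite eP !xpair_eqE AA'. Qed.

Lemma dot_block_eq A b n b' n' :
  form (e (A, b, n)) (e (A, b', n')) = ((b == b') && (n == n'))%:R.
Proof. by rewrite eP !xpair_eqE eqxx. Qed.

(** Nothing in the block of [A] is constrained, except by indices outside
    [A]. *)
Lemma bigcap_infinite_dimensional A : A \in V -> A \notin D ->
  infinite_dimensional (\bigcap_(i in [set` A]) subspace_of i).
Proof.
move=> AV AD; apply: (@infinite_dimensional_orthonormal _ _ _ form _
  (fun n => e (A, true, n))).
  by move=> m n; rewrite dot_block_eq.
move=> n i /= iA s [x xe|A' b m A'i|A' m A'D iA' _|A' m A'D iA' _].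
- exact: xe.
- by apply: dot_block; apply: contraNneq A'i => ->; rewrite AV.
- by apply: dot_block; apply: contraNneq AD => <-.
- have AA' : A' != A by apply: contraNneq AD => <-.
  by rewrite dotDl dotZl !dot_block// mulr0 addr0.
Qed.

(** The failure comes from the angle between the tilted axes and the straight
    ones, which tends to 0: the vector [y] below is in the closure of the sum,
    but a decomposition of it would need a vector with all coordinates equal to
    1 along an orthonormal sequence. *)
Lemma sum_not_closed A : D \subset V -> A \in D -> (1 < #|A|)%N ->
  ~ closed (sum_of_subspaces A perp).
Proof.
move=> DV AD A_gt1 closedA.
have AV := fintype.subsetP DV _ AD.
pose u b n := e (A, b, n).
have uP b : orthonormal_family form (u b).
  by move=> m n; rewrite dot_block_eq eqxx.
have [j jA jtilt] : exists2 j, j \in A & tilt_index A j.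
  rewrite /tilt_index; case: pickP => [j jA|A0]; first by exists j.
  by move: A_gt1; rewrite (eq_card0 A0).
have tilt_uniq i : tilt_index A i -> i = j.
  by move=> it; move: jtilt; rewrite /tilt_index (eqP it) => /eqP[].
have [k kA kj] : exists2 k, k \in A & ~~ tilt_index A k.
  have /card_gt0P[k] : (0 < #|A :\ j|)%N.
    by rewrite (cardsD1 j) jA in A_gt1.
  rewrite in_setD1 => /andP[kj kA]; exists k => //.
  by apply: contra kj => /tilt_uniq ->.
have [y ylim ycoef] := riesz_fischer conjF hilbertH (uP true) archF
  weight_square_summable.
have [w wperp yE] : sum_of_subspaces A perp y.
  apply: closed_cvg ylim => //; near=> n; rewrite seriesEord/=.
  elim/big_ind: _ => [||m _].
  - exact: sum_of_subspaces0 perp_closed_subspace.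
  - exact: sum_of_subspacesD perp_closed_subspace.
  (* Each term of the series is a tilted vector minus a straight one. *)
  rewrite -[_ *: _](addKr (u false m)) addrC.
  apply: sum_of_subspacesD; first exact: perp_closed_subspace.
    apply: (sub_sum_of_subspaces perp_closed_subspace jA).
    by apply: annihilator_perp; exact: annihilator_tilted.
  apply: (sub_sum_of_subspaces perp_closed_subspace kA).
  rewrite -scaleN1r; apply: (closed_subspaceZ (perp_closed_subspace k)).
  by apply: annihilator_perp; exact: annihilator_axis.
(* The complements of the other indices of A are orthogonal to the second
   sequence of the block, so only w j contributes to the coordinates of y. *)
have w_off i n : i \in A -> i != j -> form (w i) (u true n) = 0.
  move=> iA ij; apply: (dot_eq0C conjF); apply: (wperp i iA) => s.
  case=> [x xe|A' b m A'i|A' m A'D iA' _|A' m A'D iA' it].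
  - exact: xe.
  - by apply: dot_block; apply: contraNneq A'i => ->; rewrite AV.
  - by rewrite eP !xpair_eqE andbF.
  - have AA' : A' != A.
      apply: contraNneq ij => A'A; rewrite A'A in it.
      by rewrite (tilt_uniq _ it).
    by rewrite dotDl dotZl !dot_block// mulr0 addr0.
have wj_true n : form (w j) (u true n) = weight n.
  rewrite -ycoef yE dot_suml (bigD1 j)//= big1 ?addr0// => i /andP[iA ij].
  exact: w_off.
have wj_false n : form (w j) (u false n) = 1.
  have wE : theta (weight n) = weight n.
    by rewrite (conjugation_nneg conjF)// ltW// weight_gt0.
  (* This vector is orthogonal to the whole tilted complement. *)
  suff : form (w j) (weight n *: u false n - u true n) = 0.
    rewrite dotBr dotZr wj_true wE => /subr0_eq wn.
    by apply: (mulfI (lt0r_neq0 (weight_gt0 n))); rewrite wn mulr1.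
  apply: (dot_eq0C conjF); apply: (wperp j jA) => s.
  case=> [x xe|A' b m A'i|A' m A'D iA' itilt|A' m A'D iA' _].
  - by rewrite dotBr dotZr !xe mulr0 subr0.
  - have AA' : A' != A by apply: contraNneq A'i => ->; rewrite AV.
    by rewrite dotBr dotZr !dot_block// mulr0 subr0.
  - have AA' : A' != A by apply: contraNneq itilt => ->.
    by rewrite dotBr dotZr !dot_block// mulr0 subr0.
  - have [->|AA'] := eqVneq A' A; last first.
      by rewrite dotBr dotZr !dotDl !dotZl !dot_block// !(mulr0, addr0, subr0).
    rewrite dotBr dotZr !dotDl !dotZl !dot_block_eq/= wE !mulr0 addr0 add0r.
    by have [->|_] := eqVneq m n; rewrite ?mulr1 ?mulr0 subrr.
have [n] := archF (`|w j| ^+ 2); rewrite ger0_norm ?exprn_ge0//.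
have := bessel conjF hilbertH (uP false) (w j) n.
rewrite seriesEord/=; under eq_bigr do rewrite wj_false normr1 expr1n.
by rewrite sumr_const card_ord => /le_lt_trans /[apply]; rewrite ltxx.
Unshelve. all: by end_near. Qed.

(** A set [B] outside [V] is not included in any member of [V], because they
    have the same cardinality. *)
Lemma block_perp m (B A : {set I}) : (forall A, A \in V -> #|A| = m) ->
  #|B| = m -> B \notin V -> (0 < m)%N ->
  exists2 i, i \in B & ~~ ((A \in V) && (i \in A)).
Proof.
move=> Vm Bm BV m0; have [AV|AV] := boolP (A \in V); last first.
  by have /card_gt0P[i iB] : (0 < #|B|)%N; rewrite ?Bm//; exists i.
suff /fintype.subsetPn[i iB iA] : ~~ (B \subset A) by exists i.
apply: contra BV => BA; suff -> : B = A by [].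
by apply/eqP; rewrite eqEcard BA Bm Vm/=.
Qed.

(** A vector of the intersection is orthogonal to every block, hence among the
    vectors of kind [annihilator_rest], hence orthogonal to itself. *)
Lemma bigcap_eq0 (B : {set I}) :
  (forall A, exists2 i, i \in B & ~~ ((A \in V) && (i \in A))) ->
  \bigcap_(i in [set` B]) subspace_of i = [set 0].
Proof.
move=> BV; apply/seteqP; split=> [x xB|_ -> i _]; last first.
  by apply: closed_subspace0; exact: ortho_compl_closed_subspace.
have xe t : form x (e t) = 0.
  case: t => -[A b] n; have [i iB iA] := BV A.
  by apply: (dot_eq0C conjF); apply: (xB i iB); exact: annihilator_block.
have [i iB _] := BV B.
have : form x x = 0 by apply: (xB i iB); exact: annihilator_rest.
by rewrite -hilbertH => /eqP; rewrite expf_eq0/= normr_eq0 => /eqP.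
Qed.

(** The projection of a vector on each block lies in one of the summands, and
    what remains after removing these projections lies in all of them. *)
Lemma sum_eqT (B : {set I}) :
  (forall A, exists2 i, i \in B & ~~ ((A \in V) && (i \in A))) ->
  sum_of_subspaces B perp = [set: H].
Proof.
move=> BV; apply/seteqP; split=> // x _.
have [q qP rP] := orthonormal_decomposition conjF hilbertH x archF eP.
rewrite -(subrK (\sum_p q p) x).
apply: sum_of_subspacesD; first exact: perp_closed_subspace.
  have [i iB _] := BV B.
  apply: (sub_sum_of_subspaces perp_closed_subspace iB).
  by apply: annihilator_perp; exact: annihilator_rest.
elim/big_ind: _ => [||[A b] _].
- exact: sum_of_subspaces0 perp_closed_subspace.
- exact: sum_of_subspacesD perp_closed_subspace.
have [i iB iA] := BV A.
apply: (sub_sum_of_subspaces perp_closed_subspace iB).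
apply: qP => [|n]; first exact: perp_closed_subspace.
by apply: annihilator_perp; exact: annihilator_block.
Qed.
End Construction.

(** * The subspaces attached to a labelled family *)

Theorem proposition5p1 (R : realType) (F : numFieldType) (theta : F -> F)
    (scalars : hilbert_scalars R theta)
    (H : completeNormedModType F) (form : {dot H for theta})
    (hilbertH : induces_norm form)
    (infH : infinite_dimensional [set: H])
    (K : nat) (K_ge4 : (4 <= K)%N)
    (V : {set {set 'I_K}}) (V4 : forall A, A \in V -> #|A| = 4%N)
    (coverV : finset.cover V = [set: 'I_K]%SET)
    (alpha : {A : {set 'I_K} | A \in V} -> bool) :
  exists L : 'I_K -> set H,
    [/\ forall i, closed_subspace (L i),
        forall A : {A : {set 'I_K} | A \in V}, alpha A = false ->
          infinite_dimensional (\bigcap_(i in [set` sval A]) L i),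
        forall A : {A : {set 'I_K} | A \in V}, alpha A = true ->
          ~ closed (sum_of_subspaces (sval A) (fun i => ortho_compl form (L i)))
      & forall B : {set 'I_K}, #|B| = 4%N -> B \notin V ->
          finite_dimensional (\bigcap_(i in [set` B]) L i) /\
          closed (sum_of_subspaces B (fun i => ortho_compl form (L i)))].
Proof.
have conjF := hilbert_scalars_conjugation scalars.
have archF : Num.archimedean_axiom F := hilbert_scalars_archimedean scalars.
have [e0 e0P] := exists_orthonormal_sequence conjF hilbertH infH.
(* A single sequence is distributed among the countably many positions of all
   the blocks. *)
pose e := e0 \o (@pickle ({set 'I_K} * bool * nat)%type).
have eP : orthonormal_family form e := orthonormal_comp e0P (pcan_inj pickleK).
pose D := [set A : {set 'I_K} |
  `[< exists h : A \in V, alpha (exist _ A h) >]]%SET.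
have DV : D \subset V by apply/fintype.subsetP => A; rewrite inE => /asboolP[].
have alphaE A : (sval A \in D) = alpha A.
  case: A => A AV; rewrite inE /=.
  apply/asboolP/idP => [[h]|]; last by exists AV.
  by rewrite (bool_irrelevance h AV).
exists (subspace_of form V D e); split.
- by move=> i; exact: (ortho_compl_closed_subspace conjF hilbertH).
- move=> A A0; apply: (bigcap_infinite_dimensional eP); first exact: (svalP A).
  by rewrite alphaE A0.
- move=> A A1; apply: (sum_not_closed conjF archF hilbertH eP DV).
    by rewrite alphaE.
  by rewrite (V4 _ (svalP A)).
- move=> B B4 BV.
  have BP A := block_perp A V4 B4 BV isT.
  split; last by rewrite (sum_eqT conjF archF hilbertH D eP BP); exact: closedT.
  rewrite (bigcap_eq0 conjF hilbertH D e BP); exists [::].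
  apply/seteqP; split=> [_ ->|x [c ->]]; last by rewrite big_ord0.
  by exists (fun=> 0); rewrite big_ord0.
Qed.
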